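(* Let $(E,\|\cdot\|)$ be a finite-dimensional normed real vector space, $X\subset E$ a closed convex set, and $f,g:X\to\mathbb{R}$ convex subdifferentiable functions, where $|g(x)-g(y)|\le M_g\|x-y\|$ for all $x,y\in X$ with a constant $M_g>0$. Let $x_*$ be a solution of the problem of minimizing $f(x)$ over $x\in X$ subject to $g(x)\le 0$. Let $d:X\to\mathbb{R}$ be a distance generating function with $\min_{x\in X}d(x)=d(0)$, and let $\Theta_0$ be a constant such that $d(x_* )\le\Theta_0^2$. Let $\varepsilon>0$. Suppose that $f$ is differentiable on $X$ and that $$\|\nabla f(x)-\nabla f(y)\|_*\le L\|x-y\|\quad\text{for all }x,y\in X.$$ Then after $$N=\left\lceil\frac{2M_g^2\Theta_0^2}{\varepsilon^2}\right\rceil$$ steps of the partially adaptive Mirror Descent algorithm (described in the context), the following estimate holds: $$\min_{0\le k\le N}f(x^k)-f(x_* )\le\varepsilon_f+\frac{L}{2}\frac{\varepsilon^2}{M_g^2},\qquad\text{where}\quad \varepsilon_f=\|\nabla f(x_* )\|_*\frac{\varepsilon}{M_g}.$$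
   Context: $E^*$ is the dual space of $E$, with norm $\|y\|_*=\max\{\langle y,x\rangle:\|x\|\le 1\}$, where $\langle y,x\rangle$ is the value of $y\in E^*$ at $x\in E$. $\nabla f(x)\in E^*$ is the gradient of $f$ at $x$, and $\nabla g(x)\in E^*$ denotes a subgradient of $g$ at $x\in X$; the subgradients of $g$ satisfy $\|\nabla g(x)\|_*\le M_g$. A distance generating function is a continuously differentiable function $d:X\to\mathbb{R}$ that is $1$-strongly convex with respect to $\|\cdot\|$, i.e. $\langle\nabla d(x)-\nabla d(y),x-y\rangle\ge\|x-y\|^2$ for all $x,y\in X$. The Bregman divergence is $V(x,y)=d(y)-d(x)-\langle\nabla d(x),y-x\rangle$ for $x,y\in X$, and the mirror (proximal) map is $$\mathrm{Mirr}_x(p)=\arg\min_{u\in X}\{\langle p,u\rangle+V(x,u)\},\qquad x\in X,\ p\in E^*.$$ Algorithm (partially adaptive Mirror Descent). Start from $x^0=\arg\min_{x\in X}d(x)$ and $I=\emptyset$. For $k=0,1,\dots,N-1$: - if $g(x^k)\le\varepsilon$ (productive step), set $h_k=\frac{\varepsilon}{M_g\|\nabla f(x^k)\|_*}$, $x^{k+1}=\mathrm{Mirr}_{x^k}(h_k\nabla f(x^k))$, and add $k$ to $I$; - if $g(x^k)>\varepsilon$ (non-productive step), set $h_k=\frac{\varepsilon}{M_g^2}$ and $x^{k+1}=\mathrm{Mirr}_{x^k}(h_k\nabla g(x^k))$. The output is $\bar{x}^N=\arg\min_{x^k,\,k\in I}f(x^k)$.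
   Formalization: Added, as the claim is false otherwise: L≥0; d(0)≥0; and f with its gradient on X is the restriction of a convex function with L-Lipschitz gradient on some convex set containing X and the closed ball of radius ε/M_g around x_*. If ∇f(x^k)=0 at a productive step, h_k is taken as 0. *)

(* Defs.v *)
From HB Require Import structures.
From mathcomp Require Import all_boot all_order all_algebra.
From mathcomp Require Import all_classical all_reals all_analysis.
Set Implicit Arguments.
Unset Strict Implicit.
Unset Printing Implicit Defensive.
Import Order.TTheory GRing.Theory Num.Theory.
Import numFieldNormedType.Exports.
Local Open Scope classical_set_scope.
Local Open Scope ring_scope.

(* Finite-dimensional spaces with an arbitrary norm. *)
#[short(type="normedVectType")]
HB.structure Definition NormedVector (R : numFieldType) :=
  {E of NormedModule R E & Vector R E}.

(* In finite dimension the topological dual is the full algebraic dual. *)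
Notation dual E := 'Hom(E, _^o).

Section defs.
Context {R : realType} {E : normedVectType R}.
Implicit Types (X : set E) (f g d : E -> R) (x y u : E) (p : dual E)
  (nf ng nd : E -> dual E).

Definition dual_norm p : R := sup [set (p x : R) | x in [set x : E | `|x| <= 1]].

Definition argmin X f : set E :=
  [set x | X x /\ forall y, X y -> f x <= f y].

(* p is a gradient at x of f viewed as a function on X only: increments are
   taken inside X, so the values of f outside X are irrelevant, and p need not
   be unique when X has empty interior. *)
Definition is_gradient_within X f x p : Prop :=
  forall e : R, 0 < e -> \forall y \near within X (nbhs x),
    `|f y - f x - p (y - x)| <= e * `|y - x|.

Definition is_subgradient X g x p : Prop :=
  forall y, X y -> g x + p (y - x) <= g y.

Definition smooth_convex X f nf (L : R) : Prop :=
  [/\ convex_function X f,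
      forall x, X x -> is_gradient_within X f x (nf x)
    & forall x y, X x -> X y -> dual_norm (nf x - nf y) <= L * `|x - y|].

(* The second clause is the continuity of nd on X for the dual norm. *)
Definition distance_generating X d nd : Prop :=
  [/\ forall x, X x -> is_gradient_within X d x (nd x),
      forall x, X x ->
        dual_norm (nd y - nd x) @[y --> within X (nbhs x)] --> (0 : R)
    & forall x y, X x -> X y -> `|x - y| ^+ 2 <= (nd x - nd y) (x - y)].

Definition bregman d nd x y : R := d y - d x - nd x (y - x).

Definition Mirr X d nd x p : set E :=
  argmin X (fun u => p u + bregman d nd x u).

(* x 0, ..., x N are the iterates of N steps. If the gradient of f vanishes at
   a productive iterate, the convention 0^-1 = 0 makes the step size 0, and the
   iterate is repeated. *)
Definition mirror_descent X d nd f nf g ng (M eps : R) (N : nat)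
    (x : nat -> E) : Prop :=
  argmin X d (x 0%N) /\
  forall k, (k < N)%N ->
    (g (x k) <= eps ->
       Mirr X d nd (x k) ((eps / (M * dual_norm (nf (x k)))) *: nf (x k))
         (x k.+1)) /\
    (eps < g (x k) ->
       Mirr X d nd (x k) ((eps / M ^+ 2) *: ng (x k)) (x k.+1)).

End defs.

(* Main.v *)
(** With [r = eps / Mg], every step whose linear gain [p (x k - xs)] exceeds
    [r ^+ 2] decreases the Bregman divergence to xs by more than [r ^+ 2 / 2].
    The non-productive steps always do; if every productive step did too, the
    divergence would become negative after N steps. So some productive iterate
    [x k] satisfies [nf (x k) (x k - xs) <= dual_norm (nf (x k)) * r]: the
    half-space [nf (x k) (y - x k) >= 0], on which f is at least [f (x k)] by
    convexity, comes within distance r of xs, and smoothness at xs bounds f from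
    above on that ball. *)

Require Import Defs.
From HB Require Import structures.
From mathcomp Require Import all_boot all_order all_algebra.
From mathcomp Require Import all_classical all_reals all_analysis.
From mathcomp Require Import ring lra.
Set Implicit Arguments.
Unset Strict Implicit.
Unset Printing Implicit Defensive.
Import Order.TTheory GRing.Theory Num.Theory.
Import numFieldNormedType.Exports.
Local Open Scope classical_set_scope.
Local Open Scope ring_scope.

(** * Linear forms in finite dimension and the dual norm *)

Lemma le_coord_norm (R : realType) n (v : 'rV[R]_n) i : `|v 0 i| <= `|v|.
Proof.
rewrite [leRHS](mx_normrE v).
exact: (le_bigmax _ (fun ij => `|v ij.1 ij.2|) (0, i)).
Qed.

Section dual_norm.
Context {R : realType} {E : normedVectType R}.
Implicit Types (p : dual E) (z : E).

Let b := vbasis {:E}.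

Let comb (v : 'rV[R]_(\dim {:E})) : E := \sum_i v 0 i *: b`_i.

Let comb_continuous : continuous comb.
Proof.
apply: continuous_big => [|i _ v]; first exact: add_continuous.
exact: continuousZr_tmp (@coord_continuous R 1 _ 0 i v).
Qed.

Let comb_eq0 v : comb v = 0 -> v = 0.
Proof.
move=> cv0; apply/rowP => i; rewrite mxE.
by have /freeP := basis_free (vbasisP {:E}); apply.
Qed.

Let comb_coord z : comb (\row_i coord b i z) = z.
Proof.
rewrite [RHS](coord_vbasis (memvf z)).
by apply: eq_bigr => i _; rewrite mxE.
Qed.

Let combZ a v : comb (a *: v) = a *: comb v.
Proof. by rewrite scaler_sumr; apply: eq_bigr => i _; rewrite mxE scalerA. Qed.

(* The norm of E attains a positive minimum on the compact unit sphere of the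
   coordinate space. *)
Let comb_norm_ge : exists2 C : R, 0 < C & forall v, `|v| <= C * `|comb v|.
Proof.
pose A := [set v : 'rV[R]_(\dim {:E}) | `|v| = 1].
have norm1 v : v != 0 -> A (`|v|^-1 *: v).
  by move=> v0; rewrite /A /= normrZ normfV normr_id mulVf// normr_eq0.
(* The sphere is empty when [E] has dimension zero; any constant then works. *)
have [A0|A0] := pselect (A !=set0); last first.
  exists 1 => // v; have [->|v0] := eqVneq v 0; first by rewrite normr0 mulr_ge0.
  by exfalso; apply: A0; exists (`|v|^-1 *: v); exact: norm1.
have Ac : compact A.
  apply: bounded_closed_compact.
    by exists 1; split => // x x1 v /= ->; exact: ltW.
  rewrite (_ : A = (fun v => `|v|) @^-1` [set 1])//.
  apply: preimage_closed; first by move=> v _; exact: norm_continuous.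
  exact: closed_eq.
have Nc : continuous (fun v => `|comb v|).
  move=> v; apply: continuous_comp; [exact: comb_continuous|exact: norm_continuous].
have [c] := EVT_min_rV A0 Ac (continuous_subspaceT Nc).
rewrite inE => cA cmin.
have c0 : 0 < `|comb c|.
  rewrite normr_gt0; apply/eqP => /comb_eq0 rc0.
  by move: cA; rewrite /A /= rc0 normr0 => /eqP; rewrite eq_sym oner_eq0.
exists `|comb c|^-1; first by rewrite invr_gt0.
move=> v; have [->|v0] := eqVneq v 0; first by rewrite normr0 mulr_ge0.
have nv : 0 < `|v| by rewrite normr_gt0.
have := cmin (`|v|^-1 *: v); rewrite inE => /(_ (norm1 v v0)).
by rewrite combZ normrZ normfV normr_id ler_pdivlMl// ler_pdivlMl// mulrC.
Qed.

Lemma hom_bounded p : exists2 C : R, 0 <= C & forall z, `|p z| <= C * `|z|.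
Proof.
have [C C0 Cz] := comb_norm_ge.
exists (C * \sum_(i < \dim {:E}) `|p b`_i|); first by rewrite mulr_ge0 ?sumr_ge0// ltW.
move=> z; rewrite -(comb_coord z); move: (\row__ _) => v.
rewrite [in p _]/comb linear_sum /= mulrAC mulr_sumr.
apply: (le_trans (ler_norm_sum _ _ _)); apply: ler_sum => i _.
by rewrite linearZ normrM ler_wpM2r// (le_trans (le_coord_norm _ _)).
Qed.

(** Makes the [sup] in [dual_norm] a genuine least upper bound instead of a default value. *)
Lemma dual_norm_has_sup p :
  has_sup [set (p x : R) | x in [set x : E | `|x| <= 1]].
Proof.
split; first by exists (p 0), 0 => //=; rewrite normr0.
have [C C0 Cz] := hom_bounded p.
exists C => _ [z /= z1 <-]; rewrite (le_trans (ler_norm _))// (le_trans (Cz z))//.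
by rewrite ler_piMr.
Qed.

Lemma dual_norm_ge0 p : 0 <= dual_norm p.
Proof.
have [_ ub] := dual_norm_has_sup p.
by apply: (ub_le_sup ub); exists 0; rewrite ?linear0//= normr0.
Qed.

Lemma dual_norm_le p z : p z <= dual_norm p * `|z|.
Proof.
have [->|z0] := eqVneq z 0; first by rewrite linear0 normr0 mulr0.
have nz : 0 < `|z| by rewrite normr_gt0.
rewrite -ler_pdivrMr// mulrC.
have [_ ub] := dual_norm_has_sup p.
apply: (ub_le_sup ub); exists (`|z|^-1 *: z); last by rewrite linearZ.
by rewrite /= normrZ normfV normr_id mulVf ?gt_eqF.
Qed.

Lemma dual_norm_adherent p e : 0 < e ->
  exists2 z, `|z| <= 1 & dual_norm p - e < p z.
Proof.
by move=> /sup_adherent/(_ (dual_norm_has_sup p)) [_ [z z1 <-] ez]; exists z.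
Qed.

End dual_norm.

(** * Convex functions and gradients along segments *)

Section convex_differentiable.
Context {R : realType} {E : normedVectType R}.
Implicit Types (X : set E) (f : E -> R) (x y w : E) (p : dual E)
  (nf : E -> dual E) (t : R).

Lemma convex_set_segment X x y t : @convex_set R E X -> X x -> X y ->
  0 <= t -> t <= 1 -> X (x + t *: (y - x)).
Proof.
move=> cX Xx Xy t0 t1.
have := cX y x (Itv01 t0 t1); rewrite !inE => /(_ Xy Xx).
congr (X _); rewrite /conv /= scalerBr scalerBl scale1r.
by rewrite addrCA addrA.
Qed.

Lemma convex_function_segment X f x y t : @convex_function R E X f ->
  X x -> X y -> 0 <= t -> t <= 1 ->
  f (x + t *: (y - x)) <= f x + t * (f y - f x).
Proof.
move=> cf Xx Xy t0 t1.
have := cf (Itv01 t0 t1) y x; rewrite !inE => /(_ Xy Xx).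
congr (f _ <= _).
  rewrite /conv /= scalerBr scalerBl scale1r.
  by rewrite addrCA addrA.
by rewrite [LHS](_ : _ = t * f y + (1 - t) * f x :> R)//; ring.
Qed.

Lemma gradient_segment X f p x w : is_gradient_within X f x p ->
  forall e, 0 < e -> exists2 r, 0 < r & forall t, `|t| <= r -> X (x + t *: w) ->
    `|f (x + t *: w) - f x - t * p w| <= e * `|t|.
Proof.
move=> fxp e e0.
have w1 : 0 < `|w| + 1 by rewrite ltr_wpDl.
have [|r /= r0 rP] := (nbhs_ballP _ _).1 (fxp (e / (`|w| + 1)) _).
  by rewrite divr_gt0.
exists (r / 2 / (`|w| + 1)); first by rewrite !divr_gt0.
move=> t tr Xt.
have tw : `|t *: w| <= r / 2.
  rewrite normrZ (@le_trans _ _ (`|t| * (`|w| + 1)))//.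
    by rewrite ler_wpM2l// lerDl.
  by rewrite -ler_pdivlMr.
have xK : x + t *: w - x = t *: w by rewrite addrC addKr.
have := rP (x + t *: w); rewrite xK [p _]linearZ /= => H.
apply: le_trans (H _ Xt) _.
  rewrite -ball_normE /= opprD addNKr normrN (le_lt_trans tw)//.
  by rewrite ltr_pdivrMr// ltr_pMr// ltr1n.
rewrite normrZ mulrAC -mulrA ler_wpM2l ?(ltW e0)//.
by rewrite ler_pdivrMr// ler_wpM2l// lerDl.
Qed.

(** Convexity bounds the increment over a fraction [t] of the segment by [t * (f y - f x)].
    Comparing this with the first-order expansion and dividing by a small [t] gives the claim up to
    [e]. *)
Lemma gradient_subgradient X f p x : @convex_set R E X ->
  @convex_function R E X f -> X x ->
  is_gradient_within X f x p -> is_subgradient X f x p.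
Proof.
move=> cX cf Xx fxp y Xy; apply/ler_addgt0Pr => e e0.
have [r r0 rP] := gradient_segment (y - x) fxp e0.
pose t := Num.min r 1.
have t0 : 0 < t by rewrite lt_min r0 ltr01.
have t1 : t <= 1 by rewrite ge_min lexx orbT.
have tr : t <= r by rewrite ge_min lexx.
have := rP t; rewrite ger0_norm ?(ltW t0)// => /(_ tr).
move=> /(_ (convex_set_segment cX Xx Xy (ltW t0) t1)) /ler_normlP[+ _].
have := convex_function_segment cf Xx Xy (ltW t0) t1.
by nra.
Qed.

(* Applying the subgradient inequality backwards on each piece of a uniform
   partition of [x, y] bounds [f y - f x] by a Riemann sum, so that no
   integration is needed. *)
Lemma smooth_convex_descent X f nf L x y : @convex_set R E X ->
  smooth_convex X f nf L -> X x -> X y ->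
  f y <= f x + nf x (y - x) + L / 2 * `|y - x| ^+ 2.
Proof.
move=> cX [cf gf Lf] Xx Xy.
set w := y - x; pose a := L * `|w| ^+ 2.
have sub t : 0 <= t -> t <= 1 -> X (x + t *: w).
  exact: convex_set_segment.
(* Since [k * k.+1 / 2] is the sum of 1, ..., k, the last term is the right-endpoint Riemann sum of
   [t * a] over the first [k] pieces. *)
suff partition n k : (k <= n.+1)%N ->
    f (x + (k%:R / n.+1%:R) *: w)
    <= f x + k%:R / n.+1%:R * nf x w + a * (k * k.+1)%:R / 2 / n.+1%:R ^+ 2.
  apply/ler_addgt0Pr => e e0.
  (* At [k = n.+1] the Riemann sum differs from [a / 2] by [a / 2 / n.+1], which this choice of [n]
     keeps below [e]. *)
  have n_gt := archi_boundP (divr_ge0 (normr_ge0 a) (ltW e0)).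
  set n := Num.bound _ in n_gt.
  have n0 : 0 < n.+1%:R :> R by rewrite ltr0n.
  have := partition n n.+1 (leqnn _).
  rewrite divff ?gt_eqF// scale1r mul1r addrC subrK => /le_trans; apply.
  rewrite -[leRHS]addrA lerD2l.
  have := ler_norm a; have := normr_ge0 a.
  have -> : a * (n.+1 * n.+2)%:R / 2 / n.+1%:R ^+ 2 = a / 2 + a / 2 / n.+1%:R.
    rewrite natrM -[n.+2%:R]natr1; field; rewrite gt_eqF//.
  have aE : L / 2 * `|w| ^+ 2 = a / 2 by rewrite /a; ring.
  suff : a / n.+1%:R <= e.
    by rewrite aE; move: (n.+1%:R^-1) => h; lra.
  rewrite ler_pdivrMr// mulrC -ler_pdivrMr//.
  rewrite (le_trans _ (le_trans (ltW n_gt) _)) ?ler_nat//.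
  by rewrite ler_wpM2r ?invr_ge0 ?(ltW e0)// ler_norm.
have n0 : 0 < n.+1%:R :> R by rewrite ltr0n.
elim: k => [|k IH] kn; first by rewrite !mul0r scale0r !addr0 mulr0 !mul0r addr0.
have {}IH := IH (ltnW kn).
set s := k%:R / n.+1%:R in IH *; set t := k.+1%:R / n.+1%:R.
have s01 : 0 <= s /\ s <= 1.
  by rewrite divr_ge0// ler_pdivrMr// mul1r ler_nat ltnW.
have t01 : 0 <= t /\ t <= 1.
  by rewrite divr_ge0// ler_pdivrMr// mul1r ler_nat.
have [Xs Xt] := (sub s s01.1 s01.2, sub t t01.1 t01.2).
have ts : t = s + n.+1%:R^-1 by rewrite /t /s -natr1 mulrDl mul1r.
have := gradient_subgradient cX cf Xt (gf _ Xt) Xs.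
rewrite (_ : x + s *: w - (x + t *: w) = - n.+1%:R^-1 *: w); last first.
  by rewrite opprD addrACA subrr add0r -scalerBl ts opprD addNKr.
rewrite linearZ /= => step.
have xK : x + t *: w - x = t *: w by rewrite addrC addKr.
have := Lf _ _ Xt Xx; rewrite xK normrZ (ger0_norm t01.1) => lip.
have := dual_norm_le (nf (x + t *: w) - nf x) w.
rewrite add_lfunE opp_lfunE => dual.
have {lip}dual : nf (x + t *: w) w - nf x w <= t * a.
  rewrite (le_trans dual)// (le_trans (ler_wpM2r _ lip))//.
  by rewrite /a; lra.
set h := n.+1%:R^-1 in ts step *.
have h0 : 0 <= h by rewrite invr_ge0.
have {}step : f (x + t *: w) - h * nf (x + t *: w) w <= f (x + s *: w).
  by rewrite -mulNr.
have := ler_wpM2l h0 dual.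
move: step IH; rewrite -exprVn -/h !natrM.
have -> : k.+2%:R = k%:R + 1 + 1 :> R by rewrite !natr1.
have -> : t = (k%:R + 1) * h by rewrite natr1.
have -> : s = k%:R * h by [].
have -> : k.+1%:R = k%:R + 1 :> R by rewrite natr1.
move: (f _) (f _) (f x) (nf _ w) (nf _ w) => f1 f2 f3 p1 p2; nra.
Qed.

End convex_differentiable.

(** A supremum argument: with the slack [e * t], the set of times up to which [psi] has not dropped
    contains its supremum, and the expansion there would push it further if it were below 1. *)
Lemma nonneg_derivative_le (R : realType) (psi a : R -> R) :
  (forall t, 0 <= t -> t <= 1 -> 0 <= a t) ->
  (forall t, 0 <= t -> t <= 1 -> forall e, 0 < e -> exists2 r, 0 < r &
    forall s, 0 <= s -> s <= 1 -> `|s - t| <= r ->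
      `|psi s - psi t - (s - t) * a t| <= e * `|s - t|) ->
  psi 0 <= psi 1.
Proof.
move=> a_ge0 dpsi; apply/ler_addgt0Pr => e e0.
pose S := [set t | [/\ 0 <= t, t <= 1 & psi 0 <= psi t + e * t]].
have S0 : S 0 by split; rewrite ?mulr0 ?addr0.
have supS : has_sup S by split; [exists 0|exists 1 => t []].
have s0 : 0 <= sup S by exact: (ub_le_sup supS.2 S0).
have s1 : sup S <= 1 by apply: ge_sup; [exists 0|move=> t []].
set s := sup S in s0 s1.
have [r r0 rP] := dpsi s s0 s1 e e0.
have Ss : S s.
  have [t [t0 t1 tpsi]] := sup_adherent r0 supS; rewrite -/s => rt.
  have ts : t <= s by apply: (ub_le_sup supS.2).
  have := rP t t0 t1; rewrite ler0_norm ?subr_le0// => /(_ _)/ler_normlP[].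
    by rewrite -/s; lra.
  have := a_ge0 s s0 s1; move: tpsi; split => //; nra.
have [s_eq1|s_neq1] := eqVneq s 1.
  by case: Ss => _ _; rewrite s_eq1 mulr1.
have s_lt1 : s < 1 by rewrite lt_neqAle s_neq1.
pose t := Num.min (s + r) 1.
have st : s < t by rewrite lt_min s_lt1 ltrDl r0.
have t1 : t <= 1 by rewrite ge_min lexx orbT.
have tr : t <= s + r by rewrite ge_min lexx.
have t0 : 0 <= t by lra.
suff /(ub_le_sup supS.2) : S t by rewrite -/s leNgt st.
have := rP t t0 t1; rewrite gtr0_norm ?subr_gt0// => /(_ _)/ler_normlP[].
  by lra.
have := a_ge0 s s0 s1; case: Ss => _ _ spsi; split => //; nra.
Qed.

(** * Bregman divergence and the mirror step *)

Section bregman.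
Context {R : realType} {E : normedVectType R}.
Implicit Types (X : set E) (f d : E -> R) (x y u : E) (p : dual E)
  (nd : E -> dual E).

(** Along the segment, [d] minus its linearization at [x] and minus the quadratic term has
    derivative [a], which is nonnegative by strong monotonicity of [nd] between [x + t *: w] and
    [x]. *)
Lemma bregman_ge X d nd x y : @convex_set R E X ->
  distance_generating X d nd -> X x -> X y ->
  `|y - x| ^+ 2 / 2 <= bregman d nd x y.
Proof.
move=> cX [gd _ md] Xx Xy; rewrite /bregman.
set w := y - x.
have sub t : 0 <= t -> t <= 1 -> X (x + t *: w) by exact: convex_set_segment.
pose psi t := d (x + t *: w) - t * nd x w - t ^+ 2 / 2 * `|w| ^+ 2.
pose a t := nd (x + t *: w) w - nd x w - t * `|w| ^+ 2.
suff : psi 0 <= psi 1.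
  rewrite /psi scale0r scale1r addr0 [x + w]addrC subrK.
  by rewrite !mul0r expr0n expr1n /= !mul0r; lra.
apply: (@nonneg_derivative_le _ psi a) => [t t0 t1|t t0 t1 e e0].
  move: t0; rewrite le_eqVlt => /predU1P[<-|t0].
    by rewrite /a scale0r addr0 mul0r !subrr.
  have xK : x + t *: w - x = t *: w by rewrite addrC addKr.
  have := md _ _ (sub t (ltW t0) t1) Xx.
  rewrite xK normrZ gtr0_norm// [_ (t *: w)]linearZ /= add_lfunE opp_lfunE => mon.
  have {}mon : (t * `|w|) ^+ 2 <= t * (nd (x + t *: w) w - nd x w) := mon.
  by move: mon; rewrite exprMn expr2 -mulrA ler_pM2l// /a; lra.
(* Half of [e] pays for the expansion of [d], half for the remainder [(s - t) ^+ 2 * |w| ^+ 2 / 2]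
   of the quadratic term; hence the second radius below. *)
have e2 : 0 < e / 2 by lra.
have [r r0 rP] := gradient_segment w (gd _ (sub t t0 t1)) e2.
have w1 : 0 < `|w| ^+ 2 + 1 by rewrite ltr_wpDl.
exists (Num.min r (e / (`|w| ^+ 2 + 1))); first by rewrite lt_min r0 divr_gt0.
move=> s s0 s1; rewrite le_min => /andP[sr]; rewrite ler_pdivlMr// => se.
have xst : x + t *: w + (s - t) *: w = x + s *: w.
  by rewrite -addrA -scalerDl addrCA subrr addr0.
have := rP (s - t) sr; rewrite xst => /(_ (sub s s0 s1)).
have -> : psi s - psi t - (s - t) * a t =
    (d (x + s *: w) - d (x + t *: w) - (s - t) * nd (x + t *: w) w)
    - `|s - t| ^+ 2 * `|w| ^+ 2 / 2.
  by rewrite real_normK ?num_real// /psi /a; lra.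
move=> H; apply: (le_trans (ler_normB _ _)).
rewrite [X in _ + X]ger0_norm; last by rewrite !mulr_ge0// ?exprn_ge0.
have := normr_ge0 (s - t); have := exprn_ge0 2 (normr_ge0 w).
by nra.
Qed.

Lemma argmin_gradient X f p x u : @convex_set R E X -> argmin X f x ->
  is_gradient_within X f x p -> X u -> 0 <= p (u - x).
Proof.
move=> cX [Xx fmin] fxp Xu; apply/ler_addgt0Pr => e e0.
have [r r0 rP] := gradient_segment (u - x) fxp e0.
pose t := Num.min r 1.
have t0 : 0 < t by rewrite lt_min r0 ltr01.
have t1 : t <= 1 by rewrite ge_min lexx orbT.
have tr : t <= r by rewrite ge_min lexx.
have Xt := convex_set_segment cX Xx Xu (ltW t0) t1.
have := rP t; rewrite ger0_norm ?(ltW t0)// => /(_ tr Xt)/ler_normlP[_].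
have := fmin _ Xt.
by nra.
Qed.

Lemma bregman_argmin_le X d nd x u : @convex_set R E X ->
  distance_generating X d nd -> argmin X d x -> X u ->
  bregman d nd x u <= d u - d x.
Proof.
move=> cX [gd _ _] dx Xu.
by rewrite gerBl (argmin_gradient cX dx)//; apply: gd; case: dx.
Qed.

(** The objective has gradient [p + (nd x' - nd x)] at its minimizer [x']; first-order optimality
    tested at [u] compares the divergences. What remains, [p (x - x')] minus the divergence from [x]
    to [x'], is at most [P * D - D ^+ 2 / 2], hence at most [P ^+ 2 / 2]. *)
Lemma mirror_step X d nd p x x' u : @convex_set R E X ->
  distance_generating X d nd -> X x -> X u -> Mirr X d nd x p x' ->
  p (x - u) <= dual_norm p ^+ 2 / 2 + bregman d nd x u - bregman d nd x' u.
Proof.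
move=> cX dgf Xx Xu xmirr; have [gd _ _] := dgf; have [Xx' _] := xmirr.
have grad : is_gradient_within X (fun v => p v + bregman d nd x v) x'
    (p + (nd x' - nd x)).
  move=> e e0; near=> v.
  rewrite (_ : _ - _ = d v - d x' - nd x' (v - x')).
    by near: v; exact: gd.
  rewrite /bregman !add_lfunE opp_lfunE !linearB /=.
  by ring.
have := argmin_gradient cX xmirr grad Xu.
have := bregman_ge cX dgf Xx Xx'; rewrite /bregman.
have := dual_norm_le p (x - x'); rewrite distrC.
rewrite !add_lfunE opp_lfunE !linearB /=.
have := sqr_ge0 (dual_norm p - `|x' - x|).
move: (dual_norm p) `|x' - x| => P D.
lra.
Unshelve. all: by end_near. Qed.

End bregman.

(** * Values of smooth functions near [xs], and decrease of the divergence *)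

Section smooth_value.
Context {R : realType} {E : normedVectType R}.
Implicit Types (X D : set E) (f g d F : E -> R) (x u xs : E) (p : dual E)
  (nf ng nd nF : E -> dual E) (r h : R).

(* The last hypothesis says that xs is at distance at most r from the half-space
   [nF x (y - x) >= 0]. The supremum defining the dual norm is only approached,
   hence the slack e in the proof. *)
Lemma smooth_convex_halfspace_bound D F nF L xs x r :
  @convex_set R E D -> smooth_convex D F nF L -> 0 <= L -> 0 < r ->
  [set y | `|y - xs| <= r] `<=` D -> D x ->
  nF x (x - xs) <= dual_norm (nF x) * r ->
  F x - F xs <= dual_norm (nF xs) * r + L / 2 * r ^+ 2.
Proof.
move=> cD smoothF L0 r0 ballD Dx hyp; apply/ler_addgt0Pr => e e0.
have [cF gF _] := smoothF.
(* Moving from [xs] by [r *: z], with [z] almost attaining the dual norm of [nF x], makes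
   [nF x (y - x)] greater than [- e] at the new point [y]. *)
have [z z1 zP] := dual_norm_adherent (nF x) (divr_gt0 e0 r0).
have yxs : r *: z + xs - xs = r *: z by rewrite addrK.
have ny : `|r *: z + xs - xs| <= r.
  by rewrite yxs normrZ gtr0_norm// ger_pMr.
have Dxs : D xs by apply: ballD; rewrite /= subrr normr0 ltW.
have Dy := ballD _ ny.
have := gradient_subgradient cD cF Dx (gF _ Dx) Dy.
have -> : r *: z + xs - x = r *: z - (x - xs) by rewrite opprB addrA.
rewrite linearB /= [nF x (r *: z)]linearZ /= => below.
have {}below : F x + (r * nF x z - nF x (x - xs)) <= F (r *: z + xs) := below.
have above := smooth_convex_descent cD smoothF Dxs Dy.
have lin := dual_norm_le (nF xs) (r *: z + xs - xs).
have := ler_wpM2l (dual_norm_ge0 (nF xs)) ny.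
have L2 : 0 <= L / 2 by rewrite divr_ge0.
have := ler_wpM2l L2 (lerXn2r 2 (normr_ge0 _) (ltW r0) ny).
have : r * (dual_norm (nF x) - e / r) < r * nF x z by rewrite ltr_pM2l.
rewrite mulrBr [r * (e / r)]mulrC divfK ?gt_eqF//.
lra.
Qed.

Lemma dual_normZ_le h p : 0 <= h -> dual_norm (h *: p) <= h * dual_norm p.
Proof.
move=> h0; apply: ge_sup; first by have [] := dual_norm_has_sup (h *: p).
move=> _ [z /= z1 <-]; rewrite scale_lfunE ler_wpM2l//.
by rewrite (le_trans (dual_norm_le p z))// ler_piMr// dual_norm_ge0.
Qed.

Lemma mirror_step_lt X d nd p x x' u r : @convex_set R E X ->
  distance_generating X d nd -> X x -> X u -> Mirr X d nd x p x' ->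
  dual_norm p <= r -> r ^+ 2 < p (x - u) ->
  bregman d nd x' u < bregman d nd x u - r ^+ 2 / 2.
Proof.
move=> cX dgf Xx Xu xmirr pr gain.
have := mirror_step cX dgf Xx Xu xmirr.
have := lerXn2r 2 (dual_norm_ge0 p) (le_trans (dual_norm_ge0 p) pr) pr.
lra.
Qed.

Lemma mirror_descent_in X d nd f nf g ng M eps N
    (x : nat -> E) :
  mirror_descent X d nd f nf g ng M eps N x ->
  forall k, (k <= N)%N -> X (x k).
Proof.
move=> [[X0 _] step] [//|k] kN; have [prod nonprod] := step k kN.
by have [/prod|/nonprod] := leP (g (x k)) eps; case.
Qed.

End smooth_value.

(** The comparison point within [eps / Mg] of [xs] may leave [X], so [hext] carries [f] with the
    same constant [L] to a convex set containing that ball. The default value of the minimum is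
    harmless, as index 0 is in the range. *)
Theorem corollary1 (R : realType) (E : normedVectType R) (X : set E)
  (f g d : E -> R) (nf ng nd : E -> 'Hom(E, R^o))
  (xs : E) (Mg L Theta0 eps : R) (N : nat) (x : nat -> E)
  (hXclosed : closed X) (hXconvex : @convex_set R E X)
  (hf : smooth_convex X f nf L) (hL : 0 <= L)
  (hgconvex : convex_function X g)
  (hgsub : forall y, X y -> is_subgradient X g y (ng y))
  (hgsubM : forall y, X y -> dual_norm (ng y) <= Mg)
  (hMg : 0 < Mg)
  (hgLip : forall y z, X y -> X z -> `|g y - g z| <= Mg * `|y - z|)
  (hxs : argmin [set y | X y /\ g y <= 0] f xs)
  (hd : distance_generating X d nd)
  (hd0 : argmin X d 0) (hd0_ge0 : 0 <= d 0)
  (hTheta0 : d xs <= Theta0 ^+ 2)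
  (heps : 0 < eps)
  (hext : exists (D : set E) (F : E -> R) (nF : E -> 'Hom(E, R^o)),
     [/\ @convex_set R E D, X `<=` D,
         [set y | `|y - xs| <= eps / Mg] `<=` D,
         forall y, X y -> F y = f y /\ nF y = nf y
       & smooth_convex D F nF L])
  (hN : N%:Z = Num.ceil (2 * Mg ^+ 2 * Theta0 ^+ 2 / eps ^+ 2))
  (hx : mirror_descent X d nd f nf g ng Mg eps N x) :
  \big[Num.min/f (x 0%N)]_(0 <= k < N.+1) f (x k) - f xs
    <= dual_norm (nf xs) * (eps / Mg) + L / 2 * (eps ^+ 2 / Mg ^+ 2).
Proof.
set r := eps / Mg.
have r0 : 0 < r by rewrite divr_gt0.
have rE : eps ^+ 2 / Mg ^+ 2 = r ^+ 2 by rewrite exprMn exprVn.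
have [[Xxs gxs] _] := hxs.
have Xk := mirror_descent_in hx.
have [dx0 step] := hx.
suff [k kN kP] : exists2 k, (k <= N)%N &
    f (x k) - f xs <= dual_norm (nf xs) * r + L / 2 * r ^+ 2.
  rewrite rE (le_trans _ kP)// lerD2r.
  rewrite big_mkord.
  exact: (bigmin_le _ (Ordinal (kN : k < N.+1)%N)).
(* Optimality of [x 0] and [0 <= d 0 <= d (x 0)] bound the initial divergence by [Theta0 ^+ 2]; [N]
   is chosen to make this at most [N] decrements. *)
have V0 : bregman d nd (x 0%N) xs <= N%:R * (r ^+ 2 / 2).
  have := bregman_argmin_le hXconvex hd dx0 Xxs.
  have := hd0.2 _ (Xk _ (leq0n N)).
  have : 2 * Mg ^+ 2 * Theta0 ^+ 2 / eps ^+ 2 <= N%:R.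
    rewrite -[N%:R]/((N%:Z)%:~R) hN. exact: ceil_ge.
  rewrite ler_pdivrMr ?exprn_gt0//.
  have -> : eps = Mg * r by rewrite mulrC divfK// gt_eqF.
  rewrite exprMn => H.
  have : Mg ^+ 2 * (2 * Theta0 ^+ 2) <= Mg ^+ 2 * (N%:R * r ^+ 2) by lra.
  by rewrite ler_pM2l ?exprn_gt0//; lra.
have Vge k : (k <= N)%N -> `|xs - x k| ^+ 2 / 2 <= bregman d nd (x k) xs.
  by move=> kN; apply: (bregman_ge hXconvex hd _ Xxs); exact: Xk.
(* If [N = 0], the initial divergence is at most 0, which forces [x 0 = xs]. *)
have [N0|N0] := posnP N.
  exists 0%N => //; have := Vge 0%N (leq0n _); move: V0; rewrite N0 mul0r.
  have [->|x0xs] := eqVneq xs (x 0%N).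
    rewrite !subrr => _ _; apply: addr_ge0; first by rewrite mulr_ge0 ?dual_norm_ge0 ?ltW.
    by rewrite mulr_ge0 ?divr_ge0 ?sqr_ge0.
  have : 0 < `|xs - x 0%N| by rewrite normr_gt0 subr_eq0.
  by move=> /(exprn_gt0 2); lra.
have [[k [kN gk kP]]|noprod] := pselect (exists k, [/\ (k < N)%N, g (x k) <= eps &
    nf (x k) (x k - xs) <= dual_norm (nf (x k)) * r]).
  exists k; first exact: ltnW.
  have [D [F [nF [cD XD ballD eqF smoothF]]]] := hext.
  have [Fk nFk] := eqF _ (Xk _ (ltnW kN)); have [Fs nFs] := eqF _ Xxs.
  rewrite -Fk -Fs -nFs; apply: (smooth_convex_halfspace_bound cD smoothF) => //.
    exact/XD/Xk/ltnW.
  by rewrite nFk.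
have decr k : (k < N)%N ->
    bregman d nd (x k.+1) xs < bregman d nd (x k) xs - r ^+ 2 / 2.
  move=> kN; have [prod nonprod] := step k kN; have Xxk := Xk _ (ltnW kN).
  have [gk|gk] := leP (g (x k)) eps.
    have gain : dual_norm (nf (x k)) * r < nf (x k) (x k - xs).
      by rewrite ltNge; apply/negP => kP; apply: noprod; exists k.
    (* A vanishing gradient would give no gain, so the step size here is a true quotient. *)
    have P0 : 0 < dual_norm (nf (x k)).
      rewrite lt_neqAle dual_norm_ge0 andbT eq_sym; apply/eqP => P0.
      move: gain (dual_norm_le (nf (x k)) (x k - xs)).
      by rewrite P0 !mul0r leNgt => ->.
    have h0 : 0 < eps / (Mg * dual_norm (nf (x k))) by rewrite divr_gt0 ?mulr_gt0.
    have hP : eps / (Mg * dual_norm (nf (x k))) * dual_norm (nf (x k)) = r.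
      by rewrite /r; field; rewrite !gt_eqF.
    apply: (mirror_step_lt hXconvex hd Xxk Xxs (prod gk)).
      by rewrite (le_trans (dual_normZ_le _ (ltW h0)))// hP.
    rewrite scale_lfunE expr2 -{1}hP -mulrA.
    by rewrite [ltRHS]/GRing.scale /= ltr_pM2l.
  have h0 : 0 < eps / Mg ^+ 2 by rewrite divr_gt0 ?exprn_gt0.
  have hMgE : eps / Mg ^+ 2 * Mg = r.
    by rewrite /r; field; rewrite gt_eqF.
  apply: (mirror_step_lt hXconvex hd Xxk Xxs (nonprod gk)).
    rewrite (le_trans (dual_normZ_le _ (ltW h0)))// -hMgE.
    by rewrite ler_pM2l//; exact: hgsubM.
  rewrite scale_lfunE.
  have -> : r ^+ 2 = eps / Mg ^+ 2 * eps by rewrite -rE; ring.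
  rewrite [ltRHS]/GRing.scale /= ltr_pM2l//.
  (* From [g xs <= 0] and [eps < g (x k)], the subgradient inequality at [xs] gives a gain above
     [eps] before scaling. *)
  have := hgsub _ Xxk _ Xxs; rewrite -[xs - x k]opprB linearN /=.
  by move: gxs gk; lra.
have Vk k : (k <= N)%N ->
    bregman d nd (x k) xs <= bregman d nd (x 0%N) xs - k%:R * (r ^+ 2 / 2).
  elim: k => [_|k IH kN]; first by rewrite mul0r subr0.
  by have := decr k kN; have := IH (ltnW kN); rewrite -natr1; lra.
(* [Vk] is not strict, as it includes [k = 0]; the strict decrease of the last step makes the final
   divergence negative. *)
case: N N0 => // N _ in hN hx Xk step V0 Vge noprod decr Vk *.
have := Vk N (leqnSn _); have := decr N (leqnn _); have := Vge N.+1 (leqnn _).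
have := exprn_ge0 2 (normr_ge0 (xs - x N.+1)).
by move: V0; rewrite -natr1; lra.
Qed.
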